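(* Let $E$ be a real Banach space, let $S=\{S(t)\}_{t\ge 0}$ be a $C_0$-semigroup on $E$ with generator $A$, let $B$ be a bounded linear operator from a real Hilbert space $H$ into $E$, let $P$ be the associated Ornstein-Uhlenbeck semigroup and $P^\circ$ its restriction to $BUC^\circ(E)$. For all $t,s\ge 0$ such that $\mu_t\perp\mu_s$ we have $$\|P^\circ(t)-P^\circ(s)\|_{\mathcal{L}(BUC^\circ(E))}=2.$$
   Context: Setting. $E^*$ is the dual of $E$; $Q:=BB^*\in\mathcal{L}(E^*,E)$ (with $H$ identified with its dual). For $t\ge 0$, $Q_t\in\mathcal{L}(E^*,E)$ is given by $\langle Q_tx^*,y^*\rangle=\int_0^t\langle S(s)BB^*S^*(s)x^*,y^*\rangle\,ds$ for $x^*,y^*\in E^*$. Standing assumption: for each $t\ge 0$ there is a centred Gaussian Radon measure $\mu_t$ on $E$ with covariance operator $Q_t$, i.e. a Radon probability measure under which every $x^*\in E^*$ is a centred Gaussian random variable with variance $\langle Q_tx^*,x^*\rangle$ (so $\mu_0=\delta_0$). The Ornstein-Uhlenbeck semigroup is $P(t)f(x)=\int_E f(S(t)x+y)\,d\mu_t(y)$ for bounded real-valued continuous $f$ on $E$. $BUC(E)$ is the space of bounded real-valued uniformly continuous functions on $E$ with the supremum norm; it is $P$-invariant. $BUC^\circ(E):=\{f\in BUC(E):\lim_{t\downarrow0}\|P(t)f-f\|=0\}$, a closed $P$-invariant subspace, and $P^\circ$ is the restriction of $P$ to it. $\mathcal{L}(X)$ carries the uniform operator norm. $\mu\perp\nu$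 means that there are disjoint measurable sets $C,D$ with $\mu(C)=\nu(D)=1$. *)

(* Defs.v *)
From HB Require Import structures.
From mathcomp Require Import all_boot all_order all_algebra.
From mathcomp Require Import all_classical all_reals all_analysis.
From mathcomp Require Import ring lra.

Set Implicit Arguments.
Unset Strict Implicit.
Unset Printing Implicit Defensive.

Import Order.TTheory GRing.Theory Num.Theory.
Import numFieldNormedType.Exports.

Local Open Scope classical_set_scope.
Local Open Scope ring_scope.

Section bounded_operators.
Context {R : realType}.
Implicit Types U V W : normedModType R.

Record bounded_operator V W := BoundedOperator {
  bop_linear :> {linear V -> W} ;
  bop_continuous : continuous bop_linear }.

Definition dual V := bounded_operator V R^o.

Lemma bop_comp_continuous U V W
    (g : bounded_operator V W) (f : bounded_operator U V) :
  continuous (bop_linear g \o bop_linear f).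
Proof. by move=> x; apply: continuous_comp; exact: bop_continuous. Qed.

Definition bop_comp U V W (g : bounded_operator V W) (f : bounded_operator U V)
    : bounded_operator U W :=
  @BoundedOperator U W (bop_linear g \o bop_linear f)
    (bop_comp_continuous (g := g) (f := f)).

Definition adjoint V W (T : bounded_operator V W) (y : dual W) : dual V :=
  bop_comp y T.

End bounded_operators.

Section hilbert.
Context {R : realType}.

(* [H] is complete, so this makes it a real Hilbert space with inner product
   [dot]. *)
Definition is_hilbert (H : completeNormedModType R)
    (dot : {dot H for (@idfun R)}) :=
  forall h : H, dot h h = `|h| ^+ 2.

(* The identification of the dual of [H] with [H]; the default value is never
   used on a Hilbert space, see [rieszP]. *)
Definition riesz (H : completeNormedModType R) (dot : {dot H for (@idfun R)})
    (f : dual H) : H :=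
  xget 0 [set k | forall h : H, dot k h = f h].

Section representation.
Variables (H : completeNormedModType R) (dot : {dot H for (@idfun R)}).
Hypothesis hdot : is_hilbert dot.
Variable f : dual H.

Let dotC (h k : H) : dot h k = dot k h.
Proof. by rewrite [LHS]hermC /= expr0 mul1r. Qed.

Let sqnormD (h k : H) :
  `|h + k| ^+ 2 = `|h| ^+ 2 + 2 * dot h k + `|k| ^+ 2.
Proof.
rewrite -!hdot linearDl /= !linearDr /= (dotC k h).
by ring.
Qed.

Let J (h : H) : R := 2^-1 * `|h| ^+ 2 - f h.

Let JD (h k : H) : J (h + k) = J h + (dot h k - f k) + 2^-1 * `|k| ^+ 2.
Proof. by rewrite /J sqnormD linearD /=; field. Qed.

Let J_bounded : has_inf [set J h | h in [set: H]].
Proof.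
split; first by exists (J 0), 0.
have /linear_boundedP : bounded_near f (nbhs (0 : H)).
  by apply/linear_bounded_continuous; exact: bop_continuous.
case=> C [_ HC].
have {}HC : forall x, `|f x| <= (`|C| + 1) * `|x|.
  by apply: HC; rewrite (le_lt_trans (ler_norm C))// ltrDl.
set D := `|C| + 1 in HC.
exists (- (2^-1 * D ^+ 2)) => _ [h _ <-].
have := le_trans (ler_norm _) (HC h).
have := sqr_ge0 (`|h| - D).
rewrite /J sqrrB.
nra.
Qed.

Let m := inf [set J h | h in [set: H]].

Let m_le h : m <= J h.
Proof. by apply: ge_inf; [exact: J_bounded.2|exists h]. Qed.

Let J_midpoint (h k : H) : `|h - k| ^+ 2 <= 4 * (J h + J k - 2 * m).
Proof.
have := m_le (2^-1 *: (h + k)).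
have E1 : `|h - k| ^+ 2 = `|h| ^+ 2 - 2 * dot h k + `|k| ^+ 2.
  by rewrite sqnormD linearNr /= normrN; ring.
rewrite E1 /J normrZ exprMn sqnormD linearZ /= linearD /= ger0_norm//.
rewrite /GRing.scale /=.
lra.
Qed.

Let u_ex (n : nat) : exists h, J h < m + n.+1%:R^-1.
Proof.
have /(_ n.+1%:R^-1)[|_ [h _ <-] ?] := inf_adherent _ J_bounded.
  by rewrite invr_gt0.
by exists h.
Qed.

Let u (n : nat) : H := sval (cid (u_ex n)).

Let uP n : J (u n) < m + n.+1%:R^-1.
Proof. by rewrite /u; case: cid. Qed.

Let u_cvg : cvg (u n @[n --> \oo]).
Proof.
apply/cauchy_cvgP/cauchy_exP => e e0.
have e8 : 0 < e ^+ 2 / 8 by rewrite divr_gt0// exprn_gt0.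
have [N _ HN] := near_infty_natSinv_lt (PosNum e8).
exists (u N); exists N => // n /= Nn.
rewrite -ball_normE /= -(@ltr_pXn2r _ 2) ?nnegrE ?(ltW e0)//.
apply: (le_lt_trans (J_midpoint _ _)).
have HNe k : (N <= k)%N -> k.+1%:R^-1 < e ^+ 2 / 8 := HN k.
have := HNe N (leqnn N); have := HNe n Nn; have := uP N; have := uP n.
move: (J _) (J _) (_^-1) (N.+1%:R^-1) => a b c d; lra.
Qed.

Let J_continuous : continuous J.
Proof.
move=> x; apply: cvgB; last exact: bop_continuous.
apply: cvgM; first exact: cvg_cst.
by apply: cvgM; exact: norm_continuous.
Qed.

Let J_min h : J (lim (u n @[n --> \oo])) <= J h.
Proof.
apply: le_trans (m_le h).
set l := lim _.
have Jl : J (u n) @[n --> \oo] --> J l.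
  by apply: (continuous_cvg _ (@J_continuous l)); exact: u_cvg.
have ml : m + n.+1%:R^-1 @[n --> \oo] --> m + 0.
  by apply: cvgD; [exact: cvg_cst|exact: cvg_harmonic].
rewrite -[m]addr0; apply: (ler_cvg_to Jl ml).
by near=> n; exact: ltW (uP n).
Unshelve. all: by end_near. Qed.

Lemma riesz_ex : exists k, forall h : H, dot k h = f h.
Proof.
exists (lim (u n @[n --> \oo])) => h.
set l := lim _.
have JE t : 0 <= t * (dot l h - f h) + 2^-1 * (t ^+ 2 * `|h| ^+ 2).
  have := J_min (l + t *: h); rewrite JD -/l linearZr /= linearZ /=.
  rewrite normrZ exprMn real_normK ?num_real// /GRing.scale /=.
  by nra.
set d := dot l h - f h in JE.
suff : d = 0 by move/subr0_eq.
have h0 := sqr_ge0 `|h|.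
set q := `|h| ^+ 2 in JE h0.
have q1 : 0 < q + 1 by rewrite ltr_wpDl.
have := JE (- (d / (q + 1))).
rewrite sqrrN expr_div_n => H1.
apply/eqP; rewrite -sqrf_eq0 eq_le sqr_ge0 andbT.
move/(mulr_ge0 (sqr_ge0 (q + 1))): H1.
have -> : (q + 1) ^+ 2 *
    (- (d / (q + 1)) * d + 2^-1 * (d ^+ 2 / (q + 1) ^+ 2 * q)) =
    - (d ^+ 2) * (q / 2 + 1).
  by field; rewrite gt_eqF.
rewrite mulNr oppr_ge0 pmulr_lle0//.
by rewrite ltr_wpDl// divr_ge0.
Qed.

Lemma rieszP (h : H) : dot (riesz dot f) h = f h.
Proof.
have [k kP] := riesz_ex.
by rewrite /riesz; case: xgetP => [_ _ ->//|/(_ k)].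
Qed.

End representation.
End hilbert.

Section semigroups.
Context {R : realType} {E : completeNormedModType R}.

(* Only the values of [S] on nonnegative times are meaningful. *)
Definition C0_semigroup (S : R -> bounded_operator E E) :=
  [/\ forall x : E, S 0 x = x,
      forall t s : R, 0 <= t -> 0 <= s ->
        forall x : E, S (t + s) x = S t (S s x)
    & forall x : E, S t x @[t --> 0^'+] --> x].

(* The generator as an unbounded operator, given by its graph. *)
Definition generator (S : R -> bounded_operator E E) : set (E * E) :=
  [set xy | h^-1 *: (S h xy.1 - xy.1) @[h --> 0^'+] --> xy.2].

End semigroups.

Section gaussian_measures.
Context {R : realType}.

Definition borel (T : ptopologicalType) := g_sigma_algebraType (@open T).

Definition radon (T : ptopologicalType) (mu : probability (borel T) R) :=
  forall A : set (borel T), measurable A -> forall e : R, 0 < e ->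
    exists K : set T, [/\ compact K, K `<=` A & (mu (A `\` K) < e%:E)%E].

(* [normal_prob 0 0] is not a Dirac mass, hence the case distinction. *)
Definition centred_gaussian (v : R) (A : set R) : \bar R :=
  if v == 0 then \d_(0 : R) A else normal_prob 0 (Num.sqrt v) A.

Definition centred_gaussian_radon (E : completeNormedModType R)
    (mu : probability (borel E) R) (Q : dual E -> E) :=
  radon mu /\
  forall x' : dual E, 0 <= x' (Q x') /\
    forall A : set R, measurable A ->
      mu ((x' : E -> R) @^-1` A) = centred_gaussian (x' (Q x')) A.

Definition mutually_singular d (T : measurableType d)
    (mu nu : probability T R) :=
  exists C D : set T, [/\ measurable C, measurable D, C `&` D = set0,
    mu C = 1%E & nu D = 1%E].

(* [BB^*], through the identification of [H] with its dual *)
Definition noise_covariance (E H : completeNormedModType R)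
    (dot : {dot H for (@idfun R)}) (B : bounded_operator H E) (x' : dual E) : E :=
  B (riesz dot (adjoint B x')).

(* [Qt] is the operator [Q_t], in the weak sense. Duality separates the points
   of [E], so it is determined by this condition and is linear. *)
Definition covariance_operator (E H : completeNormedModType R)
    (S : R -> bounded_operator E E)
    (dot : {dot H for (@idfun R)}) (B : bounded_operator H E)
    (t : R) (Qt : dual E -> E) :=
  forall x' y' : dual E,
    y' (Qt x') = \int[lebesgue_measure]_(s in `[0, t])
                  y' (S s (noise_covariance dot B (adjoint (S s) x'))).

End gaussian_measures.

Section ornstein_uhlenbeck.
Context {R : realType} {E : completeNormedModType R}.

Definition OU (S : R -> bounded_operator E E)
    (mu : R -> probability (borel E) R) (t : R) (f : E -> R) (x : E) : R :=
  \int[mu t]_(y in setT) f (S t x + y).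

Definition BUC : set (E -> R) :=
  [set f | bounded_fun f /\ unif_continuous f].

Definition supnorm (f : E -> R) : \bar R :=
  ereal_sup [set `|f x|%:E | x in [set: E]].

Definition BUCo (P : R -> (E -> R) -> E -> R) : set (E -> R) :=
  BUC `&` [set f | supnorm (P t f \- f) @[t --> 0^'+] --> 0%E].

(* The operator norm, for the supremum norm, of the restriction of [T] to the
   space of functions [X]. *)
Definition opnorm (X : set (E -> R)) (T : (E -> R) -> E -> R) : \bar R :=
  ereal_sup [set supnorm (T f) | f in X `&` [set f | (supnorm f <= 1)%E]].

End ornstein_uhlenbeck.

(* Main.v *)
From HB Require Import structures.
Require Import Defs.
From mathcomp Require Import all_boot all_order all_algebra.
From mathcomp Require Import all_classical all_reals all_analysis.
From mathcomp Require Import measurable_realfun ring lra.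

Set Implicit Arguments.
Unset Strict Implicit.
Unset Printing Implicit Defensive.

Import Order.TTheory GRing.Theory Num.Theory.
Import numFieldNormedType.Exports.

Local Open Scope classical_set_scope.
Local Open Scope ring_scope.

(* The upper bound holds because each P(t) is a contraction for the supremum
   norm.  For the lower bound, separate compact sets K and L carrying most of
   mu_t and mu_s by a function g with values in [-1, 1] that is Lipschitz for a
   truncated seminorm q(x) = sum_i min(1, |x_i' x|) given by finitely many
   functionals.  The averages f_r(x) = r^-1 int_0^r g(S(u) x) du along the
   orbits of S lie in BUCo: f_r(S(h) x) is within 2 h / r of f_r(x), and
   replacing f_r(S(h) x + y) by f_r(S(h) x) under mu_h costs, by Tonelli, at
   most 2 sup_u int q(S(u) y) dmu_h(y), which is O(sqrt h) since the variance
   of each x_i' o S(u) under mu_h is O(h).  Then P(h) f_r(0) = int f_r dmu_h,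
   and f_r tends to g pointwise as r tends to 0, so that P(t) f_r - P(s) f_r at
   0 comes close to 2. *)

Lemma bop_bounded (R : realType) (V W : normedModType R)
    (T : bounded_operator V W) :
  exists2 C, 0 <= C & forall x, `|T x| <= C * `|x|.
Proof.
have /linear_boundedP : bounded_near T (nbhs (0 : V)).
  by apply/linear_bounded_continuous; exact: bop_continuous.
case=> C [_ HC]; exists (`|C| + 1); first by rewrite addr_ge0.
by apply: HC; rewrite (le_lt_trans (ler_norm C))// ltrDl.
Qed.

(** * A Hahn-Banach theorem *)

Section hahn_banach.
Context {R : realType} {E : normedModType R}.
Implicit Types (G : set (E * R)) (z : E).

(** A partial functional is represented by its graph. The value at [z] is imposed only once [G] has
    a point, so that the empty graph, the union of the empty chain in Zorn's lemma, qualifies. *)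
Let dominated z G := [/\ forall a p q, G p -> G q ->
    G (a *: p.1 + q.1, a * p.2 + q.2),
  forall p, G p -> p.2 <= `|p.1| & forall p, G p -> G (z, `|z|)].

Let line z : set (E * R) := [set (c *: z, c * `|z|) | c in [set: R]].

Let line_dominated z : dominated z (line z).
Proof.
split.
- move=> a _ _ [c _ <-] [d _ <-] /=; exists (a * c + d) => //.
  by rewrite scalerDl scalerA mulrDl mulrA.
- by move=> _ [c _ <-] /=; rewrite normrZ ler_wpM2r// ler_norm.
- by move=> _ _; exists 1 => //; rewrite scale1r mul1r.
Qed.

Let extension G (w : E) (a : R) : set (E * R) :=
  [set (p.1.1 + p.2 *: w, p.1.2 + p.2 * a) | p in G `*` [set: R]].

(** A value [a] at [w] preserves domination as soon as p.2 - |p.1 - w| <= a <= |q.1 + w| - q.2 for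
    all [p], [q] in [G]. The triangle inequality orders the outer terms, so the supremum of the
    left-hand sides will do. *)
Let extension_dominated z G w : dominated z G -> G !=set0 ->
  exists a, dominated z (extension G w a).
Proof.
move=> [lG bG zG] [p0 Gp0].
have G0 : G (0, 0).
  by have := lG (-1) _ _ Gp0 Gp0; rewrite scaleN1r mulN1r !addNr.
have GZ c p : G p -> G (c *: p.1, c * p.2).
  by move=> Gp; have := lG c _ _ Gp G0; rewrite !addr0.
have GD p q : G p -> G q -> G (p.1 + q.1, p.2 + q.2).
  by move=> Gp Gq; have := lG 1 _ _ Gp Gq; rewrite scale1r mul1r.
pose X := [set p.2 - `|p.1 - w| | p in G].
have XU q : G q -> ubound X (`|q.1 + w| - q.2).
  move=> Gq _ [p Gp <-]; rewrite lerBlDr addrAC lerBrDr.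
  have := bG _ (GD _ _ Gp Gq) => /= /le_trans; apply.
  have -> : p.1 + q.1 = (q.1 + w) + (p.1 - w) by rewrite addrACA subrr addr0 addrC.
  exact: ler_normD.
have hX : has_sup X.
  by split; [exists (p0.2 - `|p0.1 - w|), p0|exists (`|p0.1 + w| - p0.2); exact: XU].
exists (sup X); split.
- move=> c _ _ [[p x] [/= Gp _] <-] [[q y] [/= Gq _] <-] /=.
  exists ((c *: p.1 + q.1, c * p.2 + q.2), c * x + y); first by split => //; exact: lG.
  congr pair => /=; last by ring.
  by rewrite scalerDl scalerDr scalerA addrACA.
- move=> _ [[p c] [/= Gp _] <-] /=.
  (* Rescaling by the inverse of [- c] or of [c] makes the coefficient of [w] equal to -1 or 1,
     where the two bounds on [sup X] apply. *)
  have [c0|c0|->] := ltgtP c 0; last by rewrite scale0r mul0r !addr0; exact: bG.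
  + have : (- c^-1) * p.2 - `|(- c^-1) *: p.1 - w| <= sup X.
      apply: ub_le_sup; first exact: hX.2.
      by exists ((- c^-1) *: p.1, - c^-1 * p.2) => //; exact: GZ.
    have -> : (- c^-1) *: p.1 - w = (- c^-1) *: (p.1 + c *: w).
      by rewrite scalerDr scalerA mulNr mulVf ?lt_eqF// scaleN1r.
    rewrite normrZ gtr0_norm ?oppr_gt0 ?invr_lt0//.
    rewrite !mulNr opprK addrC -mulrBr mulrC ler_ndivrMr//.
    lra.
  + have : sup X <= `|c^-1 *: p.1 + w| - c^-1 * p.2.
      apply: ge_sup; first exact: hX.1.
      exact: (XU (_, _) (GZ _ _ Gp)).
    have -> : c^-1 *: p.1 + w = c^-1 *: (p.1 + c *: w).
      by rewrite scalerDr scalerA mulVf ?gt_eqF// scale1r.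
    rewrite normrZ gtr0_norm ?invr_gt0//.
    rewrite -mulrBr mulrC ler_pdivlMr//.
    lra.
- move=> _ [[p c] [/= Gp _] _].
  by exists ((z, `|z|), 0); [split => //; exact: zG Gp|rewrite scale0r mul0r !addr0].
Qed.

(** Maximality excludes the empty graph, which [line z] properly extends, and a graph missing a
    point [x], which one more dimension would enlarge. *)
Let maximal_total z G : dominated z G ->
  (forall G', G `<` G' -> ~ dominated z G') -> forall x, exists r, G (x, r).
Proof.
move=> dG maxG.
have [G0|/set0P] := eqVneq G set0.
  exfalso; apply: (maxG (line z)); last exact: line_dominated.
  by rewrite G0; split=> // /(_ (0 *: z, 0 * `|z|)); apply; exists 0.
move=> nG x; apply: contrapT => nx.
have [a dG'] := extension_dominated x dG nG.
apply: (maxG _ _ dG').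
have sG : G `<=` extension G x a.
  by move=> p Gp; exists (p, 0) => //=; rewrite scale0r mul0r !addr0; case: p Gp.
split=> // GE; apply: nx; exists a; apply: GE.
have [p Gp] := nG; have [lG _ _] := dG.
have G0 : G (0, 0) by have := lG (-1) _ _ Gp Gp; rewrite scaleN1r mulN1r !addNr.
by exists ((0, 0), 1) => //=; rewrite scale1r mul1r !add0r.
Qed.

Lemma hahn_banach_norming z :
  exists2 x' : dual E, x' z = `|z| & forall x, `|x' x| <= `|x|.
Proof.
have [F FP totF|G [dG maxG]] := @Zorn_bigcup _ (dominated z).
  split.
  - move=> a p q [X FX Xp] [Y FY Yq].
    have [XY|YX] := totF _ _ FX FY.
      by exists Y => //; have [+ _ _] := FP _ FY; apply; [exact: XY|].
    by exists X => //; have [+ _ _] := FP _ FX; apply; [|exact: YX].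
  - by move=> p [X FX Xp]; have [_ + _] := FP _ FX; apply.
  - by move=> p [X FX Xp]; exists X => //; have [_ _ +] := FP _ FX; apply; exact: Xp.
have Gex := maximal_total dG maxG.
have [lG bG zG] := dG.
(* Single-valuedness follows from domination: the difference of the two points is (0, r - s), so r -
   s <= |0|. *)
have Gfun x r s : G (x, r) -> G (x, s) -> r <= s.
  move=> Gr Gs; have := bG _ (lG (-1) _ _ Gs Gr).
  by rewrite /= scaleN1r mulN1r addNr normr0 addrC subr_le0.
pose f x : R^o := sval (cid (Gex x)).
have Gf x : G (x, f x) by rewrite /f; case: cid.
have fE x r : G (x, r) -> f x = r.
  by move=> Gr; apply/eqP; rewrite eq_le; apply/andP; split; apply: (Gfun x).
have flin : linear f by move=> a x y; apply: fE; exact: (lG a (x, _) (y, _)).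
pose fL : {linear E -> R^o} := HB.pack f (GRing.isLinear.Build _ _ _ _ _ flin).
have fN x : `|f x| <= `|x|.
  rewrite ler_norml (bG _ (Gf x))/= andbT lerNl.
  have := bG _ (Gf (- x)); rewrite /= normrN.
  by have := linearN fL x => /= ->.
have fC : continuous fL.
  apply/linear_bounded_continuous/linear_boundedP; near=> r => x.
  have r1 : 1 <= r by near: r; exact: nbhs_pinfty_ge.
  by apply: (le_trans (fN x)); rewrite ler_peMl.
by exists (BoundedOperator fC) => //=; apply: fE; exact: zG (Gf 0).
Unshelve. all: by end_near. Qed.

End hahn_banach.

(** * Orbits of a C0-semigroup *)

Section semigroup_orbits.
Context {R : realType} {E : completeNormedModType R}.
Variable S : R -> bounded_operator E E.
Hypothesis hS : C0_semigroup S.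

(** Otherwise there are times u_n in [0, 1/(n+1)] and vectors x_n of norm at most 1 with |S(u_n)
    x_n| > n. As u_n tends to 0, S(u_n) x converges for every x, so these operators are pointwise
    bounded, hence uniformly bounded by Banach-Steinhaus: a contradiction. *)
Lemma C0_locally_bounded : exists d M : R, [/\ 0 < d, 0 <= M &
  forall u x, 0 <= u <= d -> `|S u x| <= M * `|x|].
Proof.
have [_ _ S0] := hS.
suff [n hn] : exists n : nat, forall u x, 0 <= u <= n.+1%:R^-1 ->
    `|x| <= 1 -> `|S u x| <= n%:R.
  exists n.+1%:R^-1, n%:R; split => // u x u0.
  have [->|x0] := eqVneq x 0; first by rewrite linear0 !normr0 mulr0.
  have xp : 0 < `|x| by rewrite normr_gt0.
  have := hn u (`|x|^-1 *: x) u0.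
  rewrite normrZ normfV normr_id mulVf ?gt_eqF// lexx => /(_ isT).
  by rewrite linearZ /= normrZ normfV normr_id mulrC ler_pdivrMr.
apply: contrapT => /forallNP nb.
have {}nb n : exists ux : R * E, [/\ (0 <= ux.1 <= n.+1%:R^-1), `|ux.2| <= 1%R
    & n%:R < `|S ux.1 ux.2|].
  have /existsNP[u /existsNP[x /not_implyP[u0 /not_implyP[x1 /negP]]]] := nb n.
  by rewrite -ltNge => ?; exists (u, x).
have /choice[ux uxP] := nb.
pose G : set (E -> E) := [set (S (ux n).1 : E -> E) | n in [set: nat]].
have : uniform_bounded G.
  apply: Banach_Steinhauss.
  - move=> _ [n _ <-]; split; last by move=> a x y; rewrite linearP.
    move=> r; have [C C0 HC] := bop_bounded (S (ux n).1).
    by exists (C * r) => x xr; apply: le_trans (HC x) _; rewrite ler_wpM2l.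
  - move=> x.
    have cx : S (ux n).1 x @[n --> \oo] --> x.
      apply/cvgrPdist_lt => e e0.
      have [d d0 dP] : exists2 d, 0 < d & forall v, 0 <= v < d -> `|x - S v x| < e.
        have /cvgrPdist_lt/(_ e e0) := S0 x.
        move=> [d /= d0 dP]; exists d => // v /andP[v0 vd].
        have [->|vn0] := eqVneq v 0.
          by have [-> _ _] := hS; rewrite subrr normr0.
        apply: dP; last by rewrite lt_neqAle eq_sym vn0.
        by rewrite /= sub0r normrN ger0_norm.
      have [N _ HN] := near_infty_natSinv_lt (PosNum d0).
      exists N => // n /= Nn; apply: dP.
      have [/andP[-> un] _ _] := uxP n.
      exact: le_lt_trans un (HN n Nn).
    have /cvg_seq_bounded[M [_ HM]] : cvg (S (ux n).1 x @[n --> \oo]).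
      by apply/cvg_ex; exists x.
    exists (`|M| + 1) => _ [n _ <-]; apply: (HM (`|M| + 1)) => //.
    by rewrite (le_lt_trans (ler_norm M))// ltrDl.
move=> /(_ 1)[M HM].
pose n := Num.truncn M.
have [_ x1 nS] := uxP n.+1.
have GS : G (S (ux n.+1).1) by exists n.+1.
have := HM _ GS (ux n.+1).2 x1 => /(lt_le_trans nS).
by apply/negP; rewrite -leNgt; apply/ltW; exact: truncnS_gt.
Qed.

Variables (d M : R).
Hypothesis d0 : 0 < d.
Hypothesis M0 : 0 <= M.
Hypothesis SM : forall u x, 0 <= u <= d -> `|S u x| <= M * `|x|.

(* Freezing the time outside of [0, d] makes the orbits continuous on the whole
   real line. *)
Definition clip (u : R) := Num.max 0 (Num.min d u).

Lemma clip_itv u : 0 <= clip u <= d.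
Proof. by rewrite /clip le_max lexx/= ge_max (ltW d0) ge_min lexx. Qed.

Lemma clip_id u : 0 <= u <= d -> clip u = u.
Proof. by move=> /andP[u0 ud]; rewrite /clip min_r// max_r. Qed.

Lemma clip_lipschitz u v : `|clip u - clip v| <= `|u - v|.
Proof.
wlog uv : u v / u <= v => [wl|].
  have [/wl//|/ltW/wl] := leP u v.
  by rewrite distrC (distrC u).
rewrite !(distrC u) !(distrC (clip u)) (ger0_norm (x := v - u)) ?subr_ge0//.
have cE w : clip w = if w <= 0 then 0 else if w <= d then w else d.
  rewrite /clip; have [w0|w0] := leP w 0.
    by rewrite (min_r (le_trans w0 (ltW d0))) (max_l w0).
  have [wd|wd] := leP w d; first by rewrite (max_r (ltW w0)).
  by rewrite (max_r (ltW d0)).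
rewrite !cE ler_norml; have := d0; have := uv.
have [|] := leP u 0; have [|] := leP v 0; have [|] := leP u d; have [|] := leP v d;
  move=> *; apply/andP; split; lra.
Qed.

(** For u <= v one has S(v)x - S(u)x = S(u)(S(v - u)x - x), so the local bound [M] turns right
    continuity at 0 into two-sided continuity. *)
Lemma orbit_continuous x : continuous (fun u => S (clip u) x).
Proof.
have [S00 SD S0] := hS.
have key u v : 0 <= u -> u <= v -> v <= d -> `|S v x - S u x| <= M * `|S (v - u) x - x|.
  move=> u0 uv vd.
  have -> : S v x = S u (S (v - u) x) by rewrite -SD ?subr_ge0// addrC subrK.
  rewrite -linearB.
  by apply: SM; rewrite u0 (le_trans uv).
move=> u; apply/cvgrPdist_lt => e e0.
(* Dividing by [M + 1] covers the case M = 0. *)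
have e1 : 0 < e / (M + 1) by rewrite divr_gt0// ltr_wpDl.
have [eta eta0 etaP] : exists2 eta, 0 < eta &
    forall v, 0 <= v < eta -> `|S v x - x| < e / (M + 1).
  have /cvgrPdist_lt/(_ _ e1) := S0 x.
  move=> [a /= a0 aP]; exists a => // v /andP[v0 vd].
  have [->|vn0] := eqVneq v 0; first by rewrite S00 subrr normr0.
  rewrite distrC; apply: aP; last by rewrite lt_neqAle eq_sym vn0.
  by rewrite /= sub0r normrN ger0_norm.
have fin w : `|w| < e / (M + 1) -> M * `|w| < e.
  move=> we; apply: (@le_lt_trans _ _ ((M + 1) * `|w|)).
    by rewrite ler_wpM2r// lerDl.
  by rewrite mulrC -ltr_pdivlMr// ltr_wpDl.
near=> v.
have uv : `|clip u - clip v| < eta.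
  apply: le_lt_trans (clip_lipschitz _ _) _.
  by near: v; exact: cvgr_dist_lt.
have /andP[cu0 cud] := clip_itv u; have /andP[cv0 cvd] := clip_itv v.
have [cuv|/ltW cuv] := leP (clip u) (clip v).
  rewrite distrC; apply: le_lt_trans (key _ _ cu0 cuv cvd) _.
  apply/fin/etaP; rewrite subr_ge0 cuv/=; apply: le_lt_trans uv.
  by rewrite distrC ler_norm.
apply: le_lt_trans (key _ _ cv0 cuv cud) _.
apply/fin/etaP; rewrite subr_ge0 cuv/=; apply: le_lt_trans uv.
exact: ler_norm.
Unshelve. all: by end_near. Qed.

End semigroup_orbits.

(** * Integrals over segments and joint measurability *)

Section segment_integrals.
Context {R : realType}.
Notation leb := (@lebesgue_measure R).
Implicit Types f g : R -> R.

Lemma continuous_integrable_itv f a b : continuous f ->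
  leb.-integrable `[a, b] (EFin \o f).
Proof.
move=> cf; apply: continuous_compact_integrable; first exact: segment_compact.
by apply: continuous_subspaceT.
Qed.

Lemma Rintegral_itv_bound f a b c : a <= b -> continuous f ->
  (forall u, a <= u <= b -> `|f u| <= c) ->
  `|\int[leb]_(u in `[a, b]) f u| <= (b - a) * c.
Proof.
move=> ab cf fc; apply: le_trans (le_normr_Rintegral _ _) _ => //.
  exact: continuous_integrable_itv.
have -> : (b - a) * c = \int[leb]_(u in `[a, b]) c.
  rewrite Rintegral_cst//= lebesgue_measure_itv /= lte_fin.
  case: ltP => //= ba; first by rewrite mulrC.
  by rewrite mulr0 (le_anti (introT andP (conj ab ba))) subrr mul0r.
apply: le_Rintegral => //.
- apply: continuous_integrable_itv => u.
  by apply: continuous_comp; [exact: cf|exact: norm_continuous].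
- by apply: (@continuous_integrable_itv (cst c)) => u; exact: cvg_cst.
Qed.

Lemma Rintegral_itv_shift f r t : 0 <= r -> continuous f ->
  \int[leb]_(u in `[0, r]) f (u + t) = \int[leb]_(u in `[t, r + t]) f u.
Proof.
move=> r0 cf.
have dF : (fun u : R => u + t)^`()%classic = cst 1.
  apply/funext => u; rewrite derive1E deriveD// derive_id derive_cst.
  by rewrite addr0.
have cF : continuous (fun u : R => u + t).
  by move=> u; apply: cvgD; [exact: cvg_id|exact: cvg_cst].
have := @integration_by_substitution_increasing R (fun u => u + t) f 0 r r0.
rewrite dF add0r /Rintegral => ->.
- by congr fine; apply: eq_integral => u _; rewrite /= mulr1.
- by move=> x y _ _; rewrite ltrD2r.
- by move=> x _; exact: cvg_cst.
- exact: is_cvg_cst.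
- exact: is_cvg_cst.
- split.
  + by move=> x _; exact: derivableD.
  + by apply: cvg_at_right_filter; exact: cF.
  + by apply: cvg_at_left_filter; exact: cF.
- exact: continuous_subspaceT.
Qed.

Lemma Rintegral_itv_split f a c b : a <= c -> c <= b -> continuous f ->
  \int[leb]_(u in `[a, b]) f u =
    \int[leb]_(u in `[a, c]) f u + \int[leb]_(u in `[c, b]) f u.
Proof.
move=> ac cb cf.
have fI x y : leb.-integrable `[x, y] (EFin \o f) by exact: continuous_integrable_itv.
have := @Rintegral_itvB R f (BLeft a) (BRight b) c (fI a b).
rewrite !bnd_simp => /(_ ac cb).
rewrite (@Rintegral_itv_obnd_cbnd _ c (BRight b) f); first by move=> <-; rewrite addrC subrK.
apply: integrableS (fI c b) => //; apply: subset_itvr.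
by rewrite bnd_simp.
Qed.

(** The shifted integral runs over [t, r + t]. Splitting [0, r + t] at [r] and at [t] leaves the
    integral over [r, r + t] minus that over [0, t], two intervals of length [t]. *)
Lemma Rintegral_itv_shiftB f r t c : 0 <= r -> 0 <= t -> continuous f ->
  (forall u, `|f u| <= c) ->
  `|\int[leb]_(u in `[0, r]) f (u + t) - \int[leb]_(u in `[0, r]) f u|
    <= 2 * t * c.
Proof.
move=> r0 t0 cf fc; rewrite Rintegral_itv_shift//.
have E1 := @Rintegral_itv_split f 0 r (r + t) r0 (ler_wpDr t0 (lexx r)) cf.
have E2 := @Rintegral_itv_split f 0 t (r + t) t0 (ler_wpDl r0 (lexx t)) cf.
have -> : \int[leb]_(u in `[t, r + t]) f u - \int[leb]_(u in `[0, r]) f u =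
    \int[leb]_(u in `[r, r + t]) f u - \int[leb]_(u in `[0, t]) f u by lra.
apply: le_trans (ler_normB _ _) _.
have -> : 2 * t * c = (r + t - r) * c + (t - 0) * c by ring.
by apply: lerD; apply: Rintegral_itv_bound; rewrite ?lerDl.
Qed.

End segment_integrals.

Section caratheodory.
Context d {T : measurableType d} {R : realType}.
Variable h : R -> T -> R.
Hypothesis ch : forall y, continuous (h ^~ y).
Hypothesis mh : forall u, measurable_fun [set: T] (h u).

(* [h] is the pointwise limit of [h (floor (n u) / n) y]. *)
Lemma measurable_caratheodory :
  measurable_fun [set: measurableTypeR R * T] (fun z => h z.1 z.2).
Proof.
pose q n (u : R) : R := (Num.floor (u * n.+1%:R))%:~R / n.+1%:R.
apply: (@measurable_fun_cvg _ _ _ _ (fun n z => h (q n z.1) z.2)); last first.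
  move=> [u y] _ /=; apply: (cvg_comp (q ^~ u) (h ^~ y)); last exact: ch.
  apply/cvgrPdist_lt => e e0.
  have [N _ HN] := near_infty_natSinv_lt (PosNum e0).
  exists N => // n /= Nn; apply: le_lt_trans (HN n Nn).
  have n0 : 0 < n.+1%:R :> R by [].
  have /andP[h1 h2] := floor_itv (u * n.+1%:R).
  have -> : u - q n u = (u * n.+1%:R - (Num.floor (u * n.+1%:R))%:~R) / n.+1%:R.
    by rewrite mulrBl mulfK// gt_eqF.
  rewrite ger0_norm; last by rewrite divr_ge0// subr_ge0.
  by rewrite ler_pdivrMr// mulVf ?gt_eqF// lerBlDl -intrD1 ltW.
move=> n _ A mA; rewrite setTI.
(* The [n]-th approximation is constant in [u] on each cell [I k], so a preimage is a countable
   union of measurable rectangles. *)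
pose I (k : int) : set (measurableTypeR R) :=
  `[(k%:~R / n.+1%:R : R), ((k + 1)%:~R / n.+1%:R : R)[%classic.
have -> : (fun z : measurableTypeR R * T => h (q n z.1) z.2) @^-1` A =
    \bigcup_(k in [set: int]) (I k `*` (h (k%:~R / n.+1%:R) @^-1` A)).
  apply/seteqP; split => [[u y] /= Auy|[u y] [k _ [/= Iu Ay]]].
    exists (Num.floor (u * n.+1%:R)) => //; split => //=.
    rewrite /I /= in_itv/= ler_pdivrMr// ltr_pdivlMr//.
    exact: floor_itv.
  rewrite /q; suff -> : Num.floor (u * n.+1%:R) = k by [].
  apply/floor_def; move: Iu.
  by rewrite /I /= in_itv/= ler_pdivrMr// ltr_pdivlMr.
apply: countable_bigcupT_measurable => [|k]; first exact: countableP.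
apply: measurableX; first exact: measurable_itv.
by rewrite -[X in measurable X]setTI; exact: mh.
Qed.

(** Once [F] is replaced by its bound, Tonelli's theorem puts the integral in [y] inside, where it
    is at most [c] for every [u]; the interval contributes its length [r]. *)
Lemma integral_average_le (P : probability T R) (r c : R) (F : T -> R) :
  0 <= r -> (forall u y, 0 <= h u y) ->
  (forall u, 0 <= u <= r -> (\int[P]_y (h u y)%:E <= c%:E)%E) ->
  measurable_fun setT F -> (forall y, 0 <= F y) ->
  (forall y, F y <= \int[lebesgue_measure]_(u in `[0, r]) h u y) ->
  (\int[P]_y (F y)%:E <= (r * c)%:E)%E.
Proof.
move=> r0 h0 hc mF F0 Fle.
pose k (z : measurableTypeR R * T) : \bar R := (h z.1 z.2 * \1_(`[0, r]) z.1)%:E.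
have mk : measurable_fun setT k.
  apply/measurable_EFinP/measurable_funM; first exact: measurable_caratheodory.
  by apply: measurableT_comp => //; exact: measurable_indic.
have k0 z : (0 <= k z)%E by rewrite lee_fin mulr_ge0.
apply: (@le_trans _ _ (\int[P]_y \int[lebesgue_measure]_u k (u, y))%E).
  apply: ge0_le_integral => //=.
  - by move=> y _; rewrite lee_fin.
  - exact/measurable_EFinP.
  - exact: measurable_fun_fubini_tonelli_G.
  - move=> y _; apply: (@le_trans _ _ (\int[lebesgue_measure]_(u in `[0, r]) h u y)%:E).
      by rewrite lee_fin.
    rewrite fineK; last exact/integrable_fin_num/continuous_integrable_itv.
    rewrite integral_mkcond le_eqVlt; apply/orP; left; apply/eqP.
    apply: eq_integral => u _; rewrite /k /= patchE indicE.
    by case: ifPn => _; rewrite ?mulr1 ?mulr0.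
rewrite -fubini_tonelli//.
apply: (@le_trans _ _ (\int[lebesgue_measure]_(u in [set: R]) (c%:E * (\1_(`[0, r]) u)%:E))%E).
  apply: ge0_le_integral => //=.
  - by move=> u _; apply: integral_ge0 => y _; exact: k0.
  - exact: measurable_fun_fubini_tonelli_F.
  - apply: emeasurable_funM => //; apply/measurable_EFinP.
    exact: measurable_indic.
  - move=> u _; rewrite /k /=.
    under eq_integral do rewrite mulrC EFinM.
    rewrite ge0_integralZl//.
    + rewrite muleC indicE; have [|_] := boolP (u \in _).
        by rewrite inE/= in_itv/= !mule1; exact: hc.
      by rewrite !mule0.
    + exact/measurable_EFinP.
    + by move=> y _; rewrite lee_fin.
have c0 : 0 <= c.
  rewrite -lee_fin; apply: le_trans (hc 0 _); last by rewrite lexx.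
  by apply: integral_ge0 => y _; rewrite lee_fin.
rewrite ge0_integralZl//.
- rewrite integral_indic//= setIT lebesgue_measure_itv/= lte_fin sube0.
  by case: ifPn => _; rewrite ?mule0 -?EFinM lee_fin ?mulr_ge0// mulrC.
- by apply/measurable_EFinP; exact: measurable_indic.
Qed.

End caratheodory.

(** * Truncated moments of Gaussian measures *)

Section gaussian_moment.
Context {R : realType}.

(** Gaussian decay absorbs the factor |x| at the price of doubling the standard deviation.
    Integrating this bound then only requires that a density has mass 1. *)
Let normal_pdf_first_moment (s x : R) : 0 < s ->
  `|x| * normal_pdf 0 s x <= 2 * s * normal_pdf 0 (2 * s) x.
Proof.
move=> s0; have s2 : (0 < 2 * s)%R by rewrite mulr_gt0.
rewrite !normal_pdfE ?gt_eqF// /normal_peak /normal_fun subr0.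
have -> : (2 * s) ^+ 2 * pi *+ 2 = (2%R ^+ 2) * (s ^+ 2 * pi *+ 2) :> R by ring.
rewrite sqrtrM ?sqr_ge0// sqrtr_sqr (ger0_norm (ler0n R 2)).
set k := Num.sqrt _.
have k0 : (0 < k)%R.
  by rewrite /k sqrtr_gt0 mulrn_wgt0// mulr_gt0 ?pi_gt0// exprn_gt0.
rewrite invfM.
have -> : (2 * s * (2^-1 / k * expR (- x ^+ 2 / ((2 * s) ^+ 2 *+ 2))) =
  k^-1 * (s * expR (- x ^+ 2 / ((2 * s) ^+ 2 *+ 2))))%R by field; rewrite gt_eqF.
rewrite mulrCA ler_pM2l ?invr_gt0//.
have -> : (- x ^+ 2 / (s ^+ 2 *+ 2) =
   - (3 / 8 * (x / s) ^+ 2) + - x ^+ 2 / ((2 * s) ^+ 2 *+ 2))%R.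
  by field; rewrite gt_eqF.
rewrite expRD mulrA ler_pM2r ?expR_gt0// expRN ler_pdivrMr ?expR_gt0//.
rewrite -ler_pdivrMl//.
(* AM-GM, with [a = |x| / s]: [a <= 1 + 3 / 8 a ^ 2 <= expR (3 / 8 a ^ 2)] *)
apply: (@le_trans _ _ (1 + 3 / 8 * (x / s) ^+ 2)%R); last exact: expR_ge1Dx.
have -> : (s^-1 * `|x| = `|x / s|)%R by rewrite normrM normfV (gtr0_norm s0) mulrC.
rewrite -(real_normK (num_real (x / s))).
have := sqr_ge0 (3 / 4 * `|x / s| - 1)%R.
nra.
Qed.

Let integrable_truncation (s : R) :
  (normal_prob 0 s).-integrable setT (fun x => (Num.min 1 `|x|)%:E).
Proof.
have mf : measurable_fun [set: R] (fun x : R => Num.min 1 `|x|).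
  by apply: measurable_minr => //; exact: measurableT_comp.
apply/integrableP; split; first exact/measurable_EFinP.
apply: (@le_lt_trans _ _ (\int[normal_prob 0 s]_x (cst 1 x))%E); last first.
  by rewrite integral_cst//= mul1e probability_setT ltry.
apply: ge0_le_integral => //=.
  by apply/measurable_EFinP; apply: measurableT_comp.
move=> x _; rewrite lee_fin ger0_norm ?le_min ?ler01//=.
Qed.

Lemma normal_prob_truncated_moment (s : R) : 0 < s ->
  (\int[normal_prob 0 s]_x (Num.min 1 `|x|)%:E <= (2 * s)%:E)%E.
Proof.
move=> s0.
have mf : measurable_fun [set: R] (fun x : R => (Num.min 1 `|x|)%:E).
  apply/measurable_EFinP.
  by apply: measurable_minr => //; exact: measurableT_comp.
have mpdf (a : R) : measurable_fun [set: R] (fun x : R => (normal_pdf 0 a x)%:E).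
  by apply/measurable_EFinP; exact: measurable_normal_pdf.
have dom := normal_prob_dominates 0 s.
rewrite -(Radon_Nikodym_change_of_variables dom measurableT (integrable_truncation s)).
apply: (@le_trans _ _ (\int[lebesgue_measure]_(x in [set: R])
    ((Num.min 1 `|x|)%:E * (normal_pdf 0 s x)%:E))%E).
  (* The Radon-Nikodym derivative is identified with [normal_pdf] up to a null set, which suffices
     under the integral. *)
  rewrite le_eqVlt; apply/orP; left; apply/eqP; apply: ae_eq_integral => //=.
  - apply: emeasurable_funM => //; exact: (measurable_int lebesgue_measure).
  - by apply: emeasurable_funM; [exact: mf|exact: mpdf].
  - apply: ae_eqe_mul2l => /=.
    rewrite Radon_NikodymE//=.
    case: cid => /= h [h1 h2 h3].
    apply: integral_ae_eq => //=.
    + exact: mpdf.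
    + by move=> A _ mA; rewrite -h3.
apply: (@le_trans _ _ (\int[lebesgue_measure]_x ((2 * s)%:E * (normal_pdf 0 (2 * s) x)%:E))%E).
  apply: ge0_le_integral => //=.
  - by move=> x _; rewrite -EFinM lee_fin mulr_ge0 ?normal_pdf_ge0// le_min ler01 /=.
  - by apply: emeasurable_funM; [exact: mf|exact: mpdf].
  - by apply: emeasurable_funM => //; exact: mpdf.
  - move=> x _; rewrite -!EFinM lee_fin; apply: le_trans (normal_pdf_first_moment x s0).
    by rewrite ler_wpM2r ?normal_pdf_ge0// ge_min lexx orbT.
rewrite ge0_integralZl//.
- by rewrite integral_normal_pdf mule1.
- exact: mpdf.
- by move=> x _; rewrite lee_fin normal_pdf_ge0.
- by rewrite lee_fin mulr_ge0// ltW.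
Qed.

End gaussian_moment.

Section radon_gaussian.
Context {R : realType} {E : completeNormedModType R}.

Lemma measurable_borel_continuous (f : E -> R) :
  continuous f -> measurable_fun [set: borel E] (f : borel E -> R).
Proof.
move=> cf; apply: (measurability _ (RGenOpens.measurableE R)) => _ [_ [a [b ->]] <-].
rewrite setTI; apply: sub_gen_smallest; apply: open_comp => //.

Qed.

(** The law of [x'] under [mu] is the centred Gaussian with variance x'(Q x'), so the
    one-dimensional bound applies; for variance 0 the law is the Dirac mass at 0 and the integral
    vanishes. *)
Lemma gaussian_truncated_moment (mu : probability (borel E) R)
    (Q : dual E -> E) (x' : dual E) : centred_gaussian_radon mu Q ->
  (\int[mu]_y (Num.min 1 `|x' y|)%:E <= (2 * Num.sqrt (x' (Q x')))%:E)%E.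
Proof.
move=> [_ /(_ x')[v0 muE]].
have mx' : measurable_fun [set: borel E] (x' : borel E -> measurableTypeR R).
  by apply: measurable_borel_continuous; exact: bop_continuous.
have mmin : measurable_fun [set: R] (fun x : R => (Num.min 1 `|x|)%:E).
  apply/measurable_EFinP.
  by apply: measurable_minr => //; exact: measurableT_comp.
have min0 (x : R) : (0 <= (Num.min 1 `|x|)%:E)%E.
  by rewrite lee_fin le_min ler01/=.
have -> : (\int[mu]_y (Num.min 1 `|x' y|)%:E =
    \int[pushforward mu (x' : borel E -> measurableTypeR R)]_x (Num.min 1 `|x|)%:E)%E.
  by rewrite ge0_integral_pushforward//=.
have [v00|vn0] := eqVneq (x' (Q x')) 0.
  rewrite v00 sqrtr0 mulr0.
  rewrite (eq_measure_integral \d_(0 : measurableTypeR R)); last first.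
    move=> A mA _; have := muE A mA.
    by rewrite /centred_gaussian v00 eqxx.
  by rewrite integral_dirac//= normr0 diracT mul1e lee_fin ge_min lexx orbT.
rewrite (eq_measure_integral (normal_prob 0 (Num.sqrt (x' (Q x'))))); last first.
  move=> A mA _; have := muE A mA.
  by rewrite /centred_gaussian (negbTE vn0).
by apply: normal_prob_truncated_moment; rewrite sqrtr_gt0 lt_neqAle eq_sym vn0.
Qed.

End radon_gaussian.

(** * Bounds on the covariance *)

Section covariance_bound.
Context {R : realType}.

(* No measurability of [f] is needed: the integral of a nonnegative function is
   a supremum over the simple functions below it. *)
Lemma Rintegral_le_cst (t D : R) (f : R -> R) : 0 <= t -> 0 <= D ->
  (forall s, 0 <= s <= t -> 0 <= f s <= D) ->
  \int[lebesgue_measure]_(s in `[0, t]) f s <= t * D.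
Proof.
move=> t0 D0 fD.
pose I : set R := `[0, t]%classic.
have mI : measurable I by exact: measurable_itv.
suff : (\int[lebesgue_measure]_(s in I) (f s)%:E <= (t * D)%:E)%E.
  move=> h; rewrite /Rintegral -lee_fin fineK//.
  rewrite ge0_fin_numE ?(le_lt_trans h) ?ltry//.
  apply: integral_ge0 => s /=; rewrite in_itv /= => /fD /andP[+ _].
  by rewrite lee_fin.
apply: (@le_trans _ _ (\int[lebesgue_measure]_(s in I) (cst D%:E) s)%E); last first.
  rewrite integral_cst//= lebesgue_measure_itv /= lte_fin sube0.
  by case: ifPn => _; rewrite ?mule0 -?EFinM lee_fin ?mulr_ge0// mulrC.
rewrite integral_mkcond [leRHS]integral_mkcond.
rewrite !ge0_integralTE; last 2 first.
- move=> x; rewrite patchE; case: ifPn => //.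
- move=> x; rewrite patchE; case: ifPn => //.
  by rewrite inE /I /= in_itv /= => /fD /andP[+ _]; rewrite lee_fin.
apply: le_ereal_sup => _ [h /= hf <-]; exists h => //= x.
apply: le_trans (hf x) _; rewrite !patchE; case: ifPn => //.
by rewrite inE /I /= in_itv /= => /fD /andP[_ +]; rewrite lee_fin.
Qed.

(** The Riesz representative [k] of the composite of [B] and [y'] satisfies y'(B k) = |k|^2 <= C
    |k|, whence |k| <= C unless k = 0. *)
Lemma noise_quadratic_form_le (E H : completeNormedModType R)
    (dot : {dot H for (@idfun R)}) (B : bounded_operator H E) (y' : dual E)
    (C : R) : is_hilbert dot -> (forall h, `|y' (B h)| <= C * `|h|) ->
  0 <= y' (noise_covariance dot B y') <= C ^+ 2.
Proof.
move=> hH yB; rewrite /noise_covariance.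
set k := riesz dot _.
have kE : y' (B k) = `|k| ^+ 2.
  by rewrite -hH (rieszP hH (adjoint B y') k).
have kC : `|k| ^+ 2 <= C * `|k| by rewrite -{1}(ger0_norm (sqr_ge0 `|k|)) -kE.
rewrite kE sqr_ge0/=.
have [->|k0] := eqVneq `|k| 0; first by rewrite expr0n sqr_ge0.
have kp : 0 < `|k| by rewrite lt_neqAle eq_sym k0/=.
have kC' : `|k| <= C by rewrite -(ler_pM2r kp) -expr2.
by rewrite ler_pXn2r// nnegrE// (le_trans _ kC').
Qed.

End covariance_bound.

Lemma Rintegral_probability_cst (R : realType) d (T : measurableType d)
    (P : probability T R) (c : R) : \int[P]_(y in [set: T]) c = c.
Proof.
rewrite Rintegral_cst// (_ : fine _ = 1) ?mulr1//.
by rewrite -[RHS]/(fine 1%E); congr fine; exact: probability_setT.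
Qed.

Lemma bounded_continuous_integrable (R : realType) (E : completeNormedModType R)
    (P : probability (borel E) R) (f : E -> R) (c : R) :
  continuous f -> (forall x, `|f x| <= c) ->
  P.-integrable [set: borel E] (EFin \o (f : borel E -> R)).
Proof.
move=> cf fc; apply: measurable_bounded_integrable => //.
- exact: le_lt_trans (probability_le1 P measurableT) (ltry _).
- exact: measurable_borel_continuous.
- by exists c; rewrite num_real; split=> // b cb y _; exact: le_trans (fc y) (ltW cb).
Qed.

(** * Averages along the orbits *)

Section orbit_average.
Context {R : realType} {E : completeNormedModType R}.
Variable S : R -> bounded_operator E E.
Hypothesis hS : C0_semigroup S.
Variables d M : R.
Hypotheses (d0 : 0 < d) (M0 : 0 <= M).
Hypothesis SM : forall u x, 0 <= u <= d -> `|S u x| <= M * `|x|.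
Variable l : seq (dual E).

Definition trunc_seminorm (x : E) : R :=
  \sum_(x' <- l) Num.min 1 `|x' x|.
Notation q := trunc_seminorm.

Lemma trunc_seminorm_ge0 x : 0 <= q x.
Proof. by apply: sumr_ge0 => x' _; rewrite le_min ler01/=. Qed.

Lemma trunc_seminorm_le : exists2 L, 0 <= L & forall x, q x <= L * `|x|.
Proof.
rewrite /q; elim: l => [|x' s [L L0 Ls]].
  by exists 0 => // x; rewrite big_nil mul0r.
have [C C0 HC] := bop_bounded x'.
exists (C + L) => [|x]; first by rewrite addr_ge0.
rewrite big_cons mulrDl lerD//; apply: le_trans (HC x).
by rewrite ge_min lexx orbT.
Qed.

Lemma trunc_seminorm_continuous : continuous q.
Proof.
rewrite /q; elim: l => [|x' s IH].
  rewrite (_ : (fun _ => _) = cst 0); last by apply/funext => y; rewrite big_nil.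
  by move=> x; exact: cvg_cst.
rewrite (_ : (fun _ => _) = (fun y => Num.min 1 `|x' y| + \sum_(j <- s) Num.min 1 `|j y|)).
  move=> x; apply: cvgD; last exact: IH.
  apply: (@continuous_min _ _ (cst 1) (fun y => `|x' y|)); first exact: cvg_cst.
  by apply: continuous_comp; [exact: bop_continuous|exact: norm_continuous].
by apply/funext => y; rewrite big_cons.
Qed.

Variable g : E -> R.
Hypothesis g1 : forall x, `|g x| <= 1.
Hypothesis gq : forall x y, `|g x - g y| <= 2 * q (x - y).

Lemma lipschitz_continuous (f : E -> R) (L : R) :
  (forall x y, `|f x - f y| <= L * `|x - y|) -> continuous f.
Proof.
move=> fL x; apply/cvgrPdist_lt => e e0.
have L0 : 0 < `|L| + 1 by rewrite ltr_wpDl.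
near=> y; apply: le_lt_trans (fL x y) _.
apply: (@le_lt_trans _ _ ((`|L| + 1) * `|x - y|)).
  by rewrite ler_wpM2r// (le_trans (ler_norm L))// lerDl.
rewrite mulrC -ltr_pdivlMr//.
by near: y; apply: cvgr_dist_lt; rewrite ?divr_gt0.
Unshelve. all: by end_near. Qed.

Let g_continuous : continuous g.
Proof.
have [L L0 qL] := trunc_seminorm_le.
apply: (@lipschitz_continuous _ (2 * L)) => x y.
by apply: le_trans (gq x y) _; rewrite -mulrA ler_pM2l.
Qed.

Let T u := S (clip d u).

Let TM u x : `|T u x| <= M * `|x|.
Proof. exact/SM/clip_itv. Qed.

Let T_continuous x : continuous (fun u => T u x).
Proof. exact: (orbit_continuous hS d0 M0 SM). Qed.

Let comp_continuous (f : E -> R) x : continuous f -> continuous (fun u => f (T u x)).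
Proof. by move=> cf u; apply: continuous_comp; [exact: T_continuous|exact: cf]. Qed.

(** For r <= d this averages [g] over the actual orbit of [S]; the clipped family [T] makes the
    integrand continuous on the whole line. *)
Definition orbit_average (r : R) (x : E) : R :=
  r^-1 * \int[lebesgue_measure]_(u in `[0, r]) g (T u x).
Notation avg := orbit_average.

Lemma orbit_average_bound r x : 0 < r -> `|avg r x| <= 1.
Proof.
move=> r0; rewrite /avg normrM gtr0_norm ?invr_gt0// mulrC ler_pdivrMr// mul1r.
rewrite -[leRHS]mulr1 -[X in _ <= X * _]subr0.
by apply: Rintegral_itv_bound; [exact: ltW|exact: comp_continuous|move=> u _; exact: g1].
Qed.

(** Linearity of [T u] leaves only the increment x - y. The bound stays an integral in [u] because
    it serves twice: with the norm bound on [q] for the Lipschitz estimate, and integrated over the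
    increment under a Gaussian measure. *)
Lemma orbit_average_dist r x y : 0 < r ->
  r * `|avg r x - avg r y| <=
    \int[lebesgue_measure]_(u in `[0, r]) (2 * q (T u (x - y))).
Proof.
move=> r0; rewrite -{1}(gtr0_norm r0) -normrM mulrBr /avg !mulrA divff ?gt_eqF// !mul1r.
have gI z : lebesgue_measure.-integrable `[0, r] (EFin \o (fun u => g (T u z))).
  exact/continuous_integrable_itv/comp_continuous.
rewrite -RintegralB//.
have cB : continuous (fun u => g (T u x) - g (T u y)).
  by move=> u; apply: cvgB; exact: comp_continuous.
apply: le_trans (le_normr_Rintegral _ _) _ => //; first exact: continuous_integrable_itv.
apply: le_Rintegral => //.
- apply: (@continuous_integrable_itv _ (fun u => `|g (T u x) - g (T u y)|)) => u.
  exact: (cvg_norm (cB u)).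
- apply: (@continuous_integrable_itv _ (fun u => 2 * q (T u (x - y)))) => u.
  apply: cvgM; first exact: cvg_cst.
  by apply: comp_continuous; exact: trunc_seminorm_continuous.
- by move=> u _; rewrite linearB; exact: gq.
Qed.

Lemma orbit_average_lipschitz : exists L, forall r, 0 < r ->
  forall x y, `|avg r x - avg r y| <= L * `|x - y|.
Proof.
have [L L0 qL] := trunc_seminorm_le.
exists (2 * (L * M)) => r r0 x y.
rewrite -(ler_pM2l r0); apply: le_trans (orbit_average_dist _ _ r0) _.
apply: le_trans (ler_norm _) _.
rewrite -[X in _ <= X * _]subr0; apply: Rintegral_itv_bound; first exact: ltW.
- move=> u; apply: cvgM; first exact: cvg_cst.
  by apply: comp_continuous; exact: trunc_seminorm_continuous.
- move=> u _; rewrite ger0_norm ?mulr_ge0 ?trunc_seminorm_ge0//.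
  rewrite -mulrA ler_pM2l// -mulrA; apply: le_trans (qL _) _.
  exact: (ler_wpM2l L0 (TM _ _)).
Qed.

(** By the semigroup law the orbit of [S t x] is that of [x] advanced by [t], and |g| <= 1 on the
    two remaining intervals of length [t]. The condition [r + t <= d] keeps all times where [T]
    agrees with [S]. *)
Lemma orbit_average_shift r t x : 0 < r -> 0 <= t -> r + t <= d ->
  `|avg r (S t x) - avg r x| <= 2 * t / r.
Proof.
move=> r0 t0 rtd; rewrite /avg -mulrBr normrM gtr0_norm ?invr_gt0// mulrC.
rewrite ler_pM2r ?invr_gt0//.
have -> : \int[lebesgue_measure]_(u in `[0, r]) g (T u (S t x)) =
    \int[lebesgue_measure]_(u in `[0, r]) g (T (u + t) x).
  apply: eq_Rintegral => u; rewrite inE/= in_itv/= => /andP[u0 ur].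
  have [_ SD _] := hS.
  by rewrite /T !clip_id ?SD//; apply/andP; split; lra.
rewrite -[leRHS]mulr1.
apply: (@Rintegral_itv_shiftB _ (fun u => g (T u x))) => //; first exact: ltW.
exact: comp_continuous.
Qed.

Lemma orbit_average_cvg x : avg r x @[r --> 0^'+] --> g x.
Proof.
have [S00 _ _] := hS.
apply/cvgrPdist_le => e e0.
have T0 : T 0 x = x by rewrite /T clip_id ?lexx ?ltW// S00.
have [a /= a0 ha] : \forall u \near (0 : R), `|g (T 0 x) - g (T u x)| <= e.
  have /cvgrPdist_le/(_ e e0) := @comp_continuous g x g_continuous 0.
  exact.
near=> r.
have r0 : 0 < r by near: r; exact: nbhs_right_gt.
have ra : r < a by near: r; exact: nbhs_right_lt.
rewrite -(ler_pM2l r0) -{1}(gtr0_norm r0) -normrM mulrBr /avg !mulrA divff ?gt_eqF// mul1r.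
have -> : r * g x = \int[lebesgue_measure]_(u in `[0, r]) g x.
  by rewrite Rintegral_cst//= lebesgue_measure_itv /= lte_fin r0/= subr0 mulrC.
rewrite -RintegralB//; last 2 first.
- by apply: (@continuous_integrable_itv _ (cst (g x))) => u; exact: cvg_cst.
- exact/continuous_integrable_itv/comp_continuous.
rewrite -[X in _ <= X * _]subr0; apply: Rintegral_itv_bound; first exact: ltW.
- by move=> u; apply: cvgB; [exact: cvg_cst|exact: comp_continuous].
- move=> u /andP[u0 ur]; rewrite -{1}T0; apply: ha => /=.
  by rewrite sub0r normrN ger0_norm// (le_lt_trans ur).
Unshelve. all: by end_near. Qed.

(** Insert the average at z = S(t)x. Its distance to the semigroup term is at most the [mu t]-mean
    of |avg r (z + y) - avg r z|, which Tonelli bounds by 2 c; the other distance is a shift along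
    the orbit. *)
Lemma orbit_average_OU_dist (mu : R -> probability (borel E) R) (r t c : R) x :
  0 < r -> 0 <= t -> r + t <= d ->
  (forall u, (\int[mu t]_y (q (T u y))%:E <= c%:E)%E) ->
  `|OU S mu t (avg r) x - avg r x| <= 2 * c + 2 * t / r.
Proof.
move=> r0 t0 rtd qc.
have [L HL] := orbit_average_lipschitz.
have cavg : continuous (avg r) by apply: lipschitz_continuous; exact: HL.
set z := S t x.
apply: (@le_trans _ _ (`|OU S mu t (avg r) x - avg r z| + `|avg r z - avg r x|)).
  apply: le_trans (ler_normD _ _).
  by rewrite addrA subrK.
apply: lerD; last exact: orbit_average_shift.
have cF : continuous (fun y => avg r (z + y) - avg r z).
  apply: (@lipschitz_continuous _ L) => y w.
  have -> : avg r (z + y) - avg r z - (avg r (z + w) - avg r z) =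
    avg r (z + y) - avg r (z + w) by ring.
  by apply: le_trans (HL r r0 _ _) _; rewrite opprD addrACA subrr add0r.
have mF : measurable_fun [set: borel E] ((fun y => avg r (z + y) - avg r z) : borel E -> R).
  exact: measurable_borel_continuous.
have mT u : measurable_fun [set: borel E] ((fun y => 2 * q (T u y)) : borel E -> R).
  apply: measurable_borel_continuous => y; apply: cvgM; first exact: cvg_cst.
  apply: continuous_comp; first exact: bop_continuous.
  exact: trunc_seminorm_continuous.
have qT0 u y : 0 <= 2 * q (T u y) by rewrite mulr_ge0 ?trunc_seminorm_ge0.
have FI : (\int[mu t]_y (`|avg r (z + y) - avg r z|)%:E <= (2 * c)%:E)%E.
  have := @integral_average_le _ (borel E) R (fun u y => 2 * q (T u y)) _ mT (mu t) r
    (2 * c) (fun y => r * `|avg r (z + y) - avg r z|) (ltW r0) qT0.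
  under eq_integral do rewrite EFinM.
  rewrite (EFinM r) ge0_integralZl//; last 2 first.
  - by apply/measurable_EFinP; exact: measurableT_comp.
  - by rewrite lee_fin ltW.
  rewrite lee_pmul2l ?lte_fin//; apply.
  - move=> y u; apply: cvgM; first exact: cvg_cst.
    by apply: comp_continuous; exact: trunc_seminorm_continuous.
  - move=> u _; rewrite EFinM; under eq_integral do rewrite EFinM.
    rewrite ge0_integralZl//.
    + by rewrite lee_pmul2l ?lte_fin.
    + apply/measurable_EFinP; apply: measurable_borel_continuous => y.
      apply: continuous_comp; first exact: bop_continuous.
      exact: trunc_seminorm_continuous.
    + by move=> y _; rewrite lee_fin trunc_seminorm_ge0.
  - by apply: measurable_funM => //; exact: measurableT_comp.
  - by move=> y; rewrite mulr_ge0// ltW.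
  - move=> y; apply: le_trans (orbit_average_dist _ _ r0) _.
    by rewrite [z + y]addrC addrK.
have cz : continuous (fun y => avg r (z + y)).
  move=> y; apply: continuous_comp; last exact: cavg.
  by apply: cvgD; [exact: cvg_cst|exact: cvg_id].
have -> : OU S mu t (avg r) x - avg r z =
    \int[mu t]_(y in setT) (avg r (z + y) - avg r z).
  rewrite RintegralB//; last 2 first.
  - by apply: (bounded_continuous_integrable _ cz) => y; exact: orbit_average_bound.
  - exact: finite_measure_integrable_cst.
  by rewrite Rintegral_probability_cst.
rewrite -lee_fin EFin_normr_Rintegral//.
  apply: le_trans (le_abse_integral _ _ _) _ => //.
  exact/measurable_EFinP.
apply: (bounded_continuous_integrable _ cF) => y.
apply: le_trans (ler_normB _ _) _.
exact: lerD (orbit_average_bound _ r0) (orbit_average_bound _ r0).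
Qed.

End orbit_average.

(** * Strong continuity on the orbit averages *)

Section orbit_average_BUCo.
Context {R : realType} {E : completeNormedModType R}.
Variable S : R -> bounded_operator E E.
Hypothesis hS : C0_semigroup S.
Variables (H : completeNormedModType R) (dot : {dot H for (@idfun R)}).
Hypothesis hH : is_hilbert dot.
Variable B : bounded_operator H E.
Variable Q : R -> dual E -> E.
Hypothesis hQ : forall t : R, 0 <= t -> covariance_operator S dot B t (Q t).
Variable mu : R -> probability (borel E) R.
Hypothesis hmu : forall t : R, 0 <= t -> centred_gaussian_radon (mu t) (Q t).
Variables d M : R.
Hypotheses (d0 : 0 < d) (M0 : 0 <= M).
Hypothesis SM : forall u x, 0 <= u <= d -> `|S u x| <= M * `|x|.
Variable l : seq (dual E).

(** The variance is an integral over [0, t] of the quadratic form of the noise covariance at x'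
    composed with S(u) S(s). As C M M D bounds the norm of x' S(u) S(s) B, the variance is at most
    [t] times the square of this constant. *)
Let covariance_orbit_le (x' : dual E) (C D t u : R) : 0 <= C -> 0 <= D ->
  (forall x, `|x' x| <= C * `|x|) -> (forall h, `|B h| <= D * `|h|) ->
  0 <= t <= d -> 0 <= u <= d ->
  Num.sqrt ((adjoint (S u) x') (Q t (adjoint (S u) x')))
    <= C * (M * (M * D)) * Num.sqrt t.
Proof.
move=> C0 D0 HC HD /andP[t0 td] ud.
set K := C * (M * (M * D)).
have K0 : 0 <= K by rewrite /K !mulr_ge0.
have -> : K * Num.sqrt t = Num.sqrt (t * K ^+ 2).
  by rewrite sqrtrM// sqrtr_sqr ger0_norm// mulrC.
apply: ler_wsqrtr; rewrite hQ//.
apply: Rintegral_le_cst => //; first exact: sqr_ge0.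
move=> s /andP[s0 st].
apply: (noise_quadratic_form_le (y' := adjoint (S s) (adjoint (S u) x'))) => // h.
have sd : 0 <= s <= d by rewrite s0 (le_trans st).
apply: le_trans (HC _) _; rewrite /K -!mulrA ler_wpM2l//.
apply: le_trans (SM _ ud) _; rewrite ler_wpM2l//.
by apply: le_trans (SM _ sd) _; rewrite ler_wpM2l.
Qed.

(** Each functional in [l] contributes a Gaussian moment of order sqrt t. The constant is uniform in
    [u] because [clip] keeps the times in [0, d]. *)
Lemma trunc_seminorm_moment : exists2 W, 0 <= W & forall t u, 0 <= t <= d ->
  (\int[mu t]_y (trunc_seminorm l (S (clip d u) y))%:E <= (W * Num.sqrt t)%:E)%E.
Proof.
have [D D0 HD] := bop_bounded B.
have /choice[C HC] : forall x' : dual E, exists C,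
    0 <= C /\ forall x, `|x' x| <= C * `|x|.
  by move=> x'; have [C] := bop_bounded x'; exists C.
exists (\sum_(x' <- l) 2 * (C x' * (M * (M * D)))).
  by apply: sumr_ge0 => x' _; rewrite !mulr_ge0//; exact: (HC x').1.
move=> t u td; have /andP[t0 _] := td.
have mT (x' : dual E) : measurable_fun [set: borel E]
    (fun y : borel E => (Num.min 1 `|x' (S (clip d u) y)|)%:E).
  apply/measurable_EFinP; apply: measurable_minr => //.
  apply: measurableT_comp => //; 
  apply: (measurable_borel_continuous (f := adjoint (S (clip d u)) x')).
  exact: bop_continuous.
have min0 (a : R) : (0 <= (Num.min 1 `|a|)%:E)%E by rewrite lee_fin le_min ler01/=.
rewrite /trunc_seminorm.
under eq_integral do rewrite -sumEFin.
rewrite ge0_integral_sum// mulr_suml -sumEFin.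
apply: lee_sum => x' _.
apply: le_trans (gaussian_truncated_moment (adjoint (S (clip d u)) x') (hmu t0)) _.
rewrite lee_fin -mulrA ler_pM2l//.
by apply: covariance_orbit_le; rewrite ?clip_itv//; [exact: (HC x').1|exact: (HC x').2].
Qed.

Variable g : E -> R.
Hypothesis g1 : forall x, `|g x| <= 1.
Hypothesis gq : forall x y, `|g x - g y| <= 2 * trunc_seminorm l (x - y).

Lemma orbit_average_BUCo (r : R) : 0 < r -> r < d ->
  BUCo (OU S mu) (orbit_average S d g r).
Proof.
move=> r0 rd.
have [L HL] := orbit_average_lipschitz hS d0 M0 SM gq.
split; first split.
- exists 1; rewrite num_real; split=> // b b1 x _.
  exact: le_trans (orbit_average_bound hS d0 M0 SM g1 gq x r0) (ltW b1).
- apply/unif_continuousP => e e0.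
  have L0 : 0 < `|L| + 1 by rewrite ltr_wpDl.
  exists (e / (`|L| + 1)) => [|[x y]/=]; first by rewrite divr_gt0.
  rewrite -!ball_normE /= ltr_pdivlMr// mulrC => xye.
  apply: le_lt_trans (HL r r0 x y) (le_lt_trans _ xye).
  by rewrite ler_wpM2r// (le_trans (ler_norm L))// lerDl.
have [W W0 HW] := trunc_seminorm_moment.
set f := orbit_average S d g r.
(* This is the bound of [orbit_average_OU_dist] for c = W sqrt t. It does not depend on the point
   [x], so it controls the supremum norm. *)
pose b t := 2 * (W * Num.sqrt t) + 2 * t / r.
have b_cvg : (b t)%:E @[t --> 0^'+] --> 0%E.
  apply: cvg_EFin; first by near=> t.
  have b0 : b 0 = 0 by rewrite /b sqrtr0 !mulr0 mul0r addr0.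
  have : b t @[t --> 0^'+] --> b 0.
    apply: cvg_at_right_filter.
    apply: cvgD; first (apply: cvgM; first exact: cvg_cst).
      by apply: cvgM; [exact: cvg_cst|exact: sqrt_continuous].
    by apply: cvgM; [apply: cvgM; [exact: cvg_cst|exact: cvg_id]|exact: cvg_cst].
  by rewrite b0.
apply: (@squeeze_cvge _ _ _ _ (cst 0%E) _ (fun t => (b t)%:E)) => //; last exact: cvg_cst.
near=> t.
have t0 : 0 < t by near: t; exact: nbhs_right_gt.
(* The strict inequality [r < d] leaves room for small [t] with r + t <= d. *)
have td : t < d - r by near: t; apply: nbhs_right_lt; rewrite subr_gt0.
apply/andP; split.
  apply: le_ereal_sup_tmp; exists `|(OU S mu t f \- f) 0|%:E; first by exists (0 : E).
  by rewrite lee_fin normr_ge0.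
apply: ge_ereal_sup => _ [x _ <-]; rewrite lee_fin /b.
apply: (orbit_average_OU_dist hS d0 M0 SM g1 gq) => //; first by lra.
by move=> u; apply: HW; apply/andP; split; lra.
Unshelve. all: by end_near. Qed.

End orbit_average_BUCo.

(** * Separation of compact sets *)

Section separation.
Context {R : realType} {E : completeNormedModType R}.

(** The value 2 exceeds 1 strictly, so |x'| > 1 on a whole neighbourhood of [z], as the covering
    argument below requires. *)
Lemma dual_point_eq2 (z : E) : z != 0 -> exists x' : dual E, x' z = 2.
Proof.
move=> z0; have [x' x'z _] := hahn_banach_norming z.
have cS : continuous ((2 / `|z|) \*: bop_linear x' : {linear E -> R^o}).
  move=> x; apply: cvgM; first exact: cvg_cst.
  exact: bop_continuous.
exists (BoundedOperator cS) => /=.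
by rewrite /= x'z /GRing.scale /= divfK// normr_eq0.
Qed.

(** Finitely many of the open sets where |x'_z| > 1 cover [D], so at each point of [D] some
    truncated term equals 1 while the others are nonnegative. *)
Lemma compact_trunc_seminorm_ge1 (D : set E) : compact D -> ~ D 0 ->
  exists l : seq (dual E), forall x, D x -> 1 <= trunc_seminorm l x.
Proof.
move=> cD D0.
(* At z = 0 any functional serves as a default; [D] avoids 0. *)
have /choice[x' hx'] : forall z : E, exists x' : dual E, z != 0 -> x' z = 2.
  move=> z; have [->|/dual_point_eq2[x' <-]] := eqVneq z 0; last by exists x'.
  by have [x' _ _] := hahn_banach_norming (0 : E); exists x'.
pose U z := [set x : E | 1 < `|x' z x|].
have Uopen z : D z -> open (U z).
  move=> _; apply: (@open_comp _ _ (fun x => `|x' z x|) [set a | 1 < a]).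
    by move=> x _; apply: continuous_comp; [exact: bop_continuous|exact: norm_continuous].
  exact: open_gt.
move: cD; rewrite compact_cover => /(_ E D U Uopen)[|F FD DF].
  move=> z Dz; exists z => //; rewrite /U /= hx' ?ger0_norm ?ltr1n//.
  by apply/eqP => z0; apply: D0; rewrite -z0.
exists [seq x' z | z <- finmap.enum_fset F] => x /DF[z /= zF Uzx].
rewrite /trunc_seminorm big_map (big_rem z)//=.
rewrite (min_l (ltW Uzx)) lerDl.
by apply: sumr_ge0 => w _; rewrite le_min ler01/=.
Qed.

Lemma trunc_seminormD (l : seq (dual E)) x y :
  trunc_seminorm l (x + y) <= trunc_seminorm l x + trunc_seminorm l y.
Proof.
rewrite /trunc_seminorm -big_split/=; apply: ler_sum => x' _.
rewrite linearD/=; have := ler_normD (x' x) (x' y).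
have := normr_ge0 (x' x); have := normr_ge0 (x' y).
move: `|x' x| `|x' y| `|x' x + x' y| => a b c b0 a0 cab.
have [|] := leP 1 c; have [|] := leP 1 a; have [|] := leP 1 b; move=> *; lra.
Qed.

Lemma trunc_seminormN (l : seq (dual E)) x :
  trunc_seminorm l (- x) = trunc_seminorm l x.
Proof. by apply: eq_bigr => x' _; rewrite linearN normrN. Qed.

(** The compact set of differences x - y, with x in [K] and y in [L], avoids 0, so some truncated
    seminorm q is at least 1 on it. With D the q-distance to [K], the function 1 - 2 min(1, D) has
    the required values; D is 1-Lipschitz for q, hence the factor 2. *)
Lemma compact_separation (K L : set E) : compact K -> compact L ->
  K !=set0 -> K `&` L = set0 ->
  exists (l : seq (dual E)) (g : E -> R), [/\ forall x, `|g x| <= 1,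
    forall x y, `|g x - g y| <= 2 * trunc_seminorm l (x - y),
    forall x, K x -> g x = 1 & forall x, L x -> g x = -1].
Proof.
move=> cK cL [k0 Kk0] KL.
have [||l hl] := @compact_trunc_seminorm_ge1 ((fun z => z.1 - z.2) @` (K `*` L)).
- apply: continuous_compact; last exact: compact_setX.
  apply: continuous_subspaceT => z; apply: cvgB; [exact: cvg_fst|exact: cvg_snd].
- move=> [[x y] [/= Kx Ly] /subr0_eq xy].
  have : (K `&` L) x by split => //; rewrite xy.
  by rewrite KL.
set q := trunc_seminorm l in hl.
have qC x y : q (x - y) = q (y - x) by rewrite /q -trunc_seminormN opprB.
pose A x := [set q (c - x) | c in K].
have lA x : lbound (A x) 0 by move=> _ [c _ <-]; exact: trunc_seminorm_ge0.
have iA x : has_inf (A x) by split; [exists (q (k0 - x)), k0|exists 0].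
pose D x := inf (A x).
have D0 x : 0 <= D x by apply: lb_le_inf => //; exact: (iA x).1.
have Dq x y : D x <= D y + q (x - y).
  rewrite -lerBlDr; apply: lb_le_inf; first exact: (iA y).1.
  move=> _ [c Kc <-]; rewrite lerBlDr.
  apply: (@le_trans _ _ (q (c - x))).
    by apply: ge_inf; [exact: (iA x).2|exists c].
  rewrite qC.
  have -> : c - x = (c - y) + (y - x) by rewrite addrA subrK.
  exact: trunc_seminormD.
exists l, (fun x => 1 - 2 * Num.min 1 (D x)); split.
- move=> x; rewrite ler_norml; have := D0 x.
  by have [|] := leP 1 (D x); move=> *; apply/andP; split; lra.
- move=> x y; rewrite ler_norml; have := Dq x y; have := Dq y x.
  rewrite qC.
  have := trunc_seminorm_ge0 l (y - x); rewrite -/q.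
  have [|] := leP 1 (D x); have [|] := leP 1 (D y); move=> *; apply/andP; split; lra.
- move=> x Kx.
  have -> : D x = 0.
    apply/eqP; rewrite eq_le D0 andbT; apply: ge_inf; first exact: (iA x).2.
    exists x => //; rewrite subrr /q /trunc_seminorm big1// => x' _.
    by rewrite linear0 normr0 min_r.
  by rewrite min_r// mulr0 subr0.
- move=> x Lx; rewrite min_l; first by lra.
  apply: lb_le_inf; first exact: (iA x).1.
  by move=> _ [c Kc <-]; apply: hl; exists (c, x).
Qed.

End separation.

(** * Integrals of separating functions and their limits *)

Section lower_bound.
Context {R : realType} {E : completeNormedModType R}.

Lemma compact_borel_measurable (K : set E) : compact K -> measurable (K : set (borel E)).
Proof.
move=> cK; rewrite -[K]setCK; apply: measurableC; apply: sub_gen_smallest.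
apply: closed_openC; apply: compact_closed => //.
Qed.

(* [f >= 1 - 2 * \1_(~` K)] *)
Lemma Rintegral_concentrated_ge (P : probability (borel E) R)
    (C K : set (borel E)) (f : E -> R) (e : R) :
  measurable C -> P C = 1%E -> compact (K : set E) -> (P (C `\` K) < e%:E)%E ->
  continuous f -> (forall x, `|f x| <= 1) -> (forall x, K x -> f x = 1) ->
  1 - 2 * e <= \int[P]_(y in [set: borel E]) f y.
Proof.
move=> mC PC cK PCK cf f1 fK.
have mK : measurable K by exact: compact_borel_measurable.
have mK' : measurable (~` K) by exact: measurableC.
have PK : (P (~` K) < e%:E)%E.
  (* As [C] has full measure, the complement of [K] has no more mass than [C] minus [K]. *)
  have KCU : ~` K `<=` (C `\` K) `|` ~` C.
    by move=> x Kx; have [Cx|Cx] := pselect (C x); [left|right].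
  apply: le_lt_trans PCK.
  apply: (@le_trans _ _ (P ((C `\` K) `|` ~` C))).
    apply: le_measure KCU; rewrite inE//.
    by apply: measurableU; [exact: measurableD|exact: measurableC].
  apply: (@le_trans _ _ (P (C `\` K) + P (~` C))%E).
    by apply: measureU2; [exact: measurableD|exact: measurableC].
  by rewrite (probability_setC P)// PC subee// adde0.
have iI : P.-integrable [set: borel E] (EFin \o \1_(~` K)).
  by apply: integrable_indic.
have i2I : P.-integrable [set: borel E] (EFin \o (fun y => 2 * \1_(~` K) y)).
  apply: (eq_integrable measurableT (fun y => (2%:E * (\1_(~` K) y)%:E)%E)) => //.
  exact: integrableZl.
have i1I : P.-integrable [set: borel E] (EFin \o (fun=> 1 : R)).
  exact: (finite_measure_integrable_cst P 1).
apply: (@le_trans _ _ (\int[P]_(y in [set: borel E]) (1 - 2 * \1_(~` K) y))).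
  rewrite RintegralB// Rintegral_probability_cst RintegralZl//.
  rewrite lerD2l lerN2 ler_pM2l//.
  rewrite /Rintegral integral_indic// setIT -lee_fin fineK ?ltW//.
  by rewrite ge0_fin_numE// (lt_le_trans PK)// leey.
apply: le_Rintegral => //.
- apply: (eq_integrable measurableT (fun y => (1%:E - (2 * \1_(~` K) y)%:E)%E)) => //.
  exact: integrableB.
- exact: bounded_continuous_integrable f1.
- move=> x _; rewrite indicE; have [_|] := boolP (x \in ~` K).
    by rewrite mulr1; have := f1 x; rewrite ler_norml => /andP[+ _]; lra.
  by rewrite notin_setE /= => /contrapT /fK ->; rewrite mulr0 subr0.
Qed.

Lemma Rintegral_cvg_bounded (P : probability (borel E) R)
    (f : nat -> E -> R) (g : E -> R) :
  (forall n, continuous (f n)) -> (forall n x, `|f n x| <= 1) ->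
  (forall x, f n x @[n --> \oo] --> g x) ->
  \int[P]_(y in [set: borel E]) f n y @[n --> \oo] -->
  \int[P]_(y in [set: borel E]) g y.
Proof.
move=> cf f1 fg.
have mf n : measurable_fun [set: borel E] (f n : borel E -> R).
  exact: measurable_borel_continuous.
have mg : measurable_fun [set: borel E] (g : borel E -> R).
  by apply: (measurable_fun_cvg (h := fun n => (f n : borel E -> R))) => // x _; exact: fg.
have g1 x : `|g x| <= 1.
  have c1 : (fun=> 1 : R) n @[n --> \oo] --> (1 : R) by exact: cvg_cst.
  have nfg : `|f n x| @[n --> \oo] --> `|g x| by exact: (cvg_norm (fg x)).
  by apply: (ler_cvg_to nfg c1); apply: nearW => n; exact: f1.
apply: fine_cvg; rewrite fineK.
  apply: (@dominated_cvg _ _ _ P [set: borel E] measurableT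
     (fun n y => (f n y)%:E) (fun y => (g y)%:E) (cst 1%E)) => //.
  - by move=> n; apply/measurable_EFinP.
  - by move=> x _; apply: cvg_EFin; [exact: nearW|exact: fg].
  - exact: (finite_measure_integrable_cst P 1).
  - by move=> n x _; rewrite lee_fin; exact: f1.
apply: integrable_fin_num => //.
apply: measurable_bounded_integrable => //.
- exact: le_lt_trans (probability_le1 P measurableT) (ltry _).
- by exists 1; rewrite num_real; split=> // b b1 y _; exact: le_trans (g1 y) (ltW b1).
Qed.

End lower_bound.

(** * The upper bound and the norm identity *)

Lemma opnorm_OU_le (R : realType) (E : completeNormedModType R)
  (S : R -> bounded_operator E E) (mu : R -> probability (borel E) R)
  (X : set (E -> R)) (t s : R) : X `<=` BUC ->
  (opnorm X (fun f => (OU S mu t f \- OU S mu s f)%R) <= 2%:E)%E.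
Proof.
move=> XB; apply: ge_ereal_sup => _ [f [/XB [_ uf] f1] <-].
apply: ge_ereal_sup => _ [x _ <-]; rewrite lee_fin.
have cf : continuous f.
  move=> y; apply/cvgrPdist_lt => e e0.
  have /unif_continuousP/(_ e e0)[b b0 fb] := uf.
  near=> z; have := fb (y, z); rewrite -!ball_normE /=; apply.
  by near: z; exact: cvgr_dist_lt.
have {}f1 y : `|f y| <= 1.
  rewrite -lee_fin; apply: le_trans f1; apply: ereal_sup_ubound.
  by exists y.
(* Each value is a mean of [f] against a probability measure, so it inherits the bound 1. *)
have OU1 r : `|OU S mu r f x : R| <= 1.
  have cfx : continuous (fun y => f (S r x + y)).
    move=> y; apply: continuous_comp; last exact: cf.
    by apply: cvgD; [exact: cvg_cst|exact: cvg_id].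
  have cn : continuous (fun y => `|f (S r x + y)|).
    by move=> y; exact: (cvg_norm (cfx y)).
  rewrite /OU; apply: le_trans (le_normr_Rintegral _ _) _ => //.
    by apply: (bounded_continuous_integrable _ cfx) => y; exact: f1.
  rewrite -[leRHS](Rintegral_probability_cst (mu r)).
  apply: le_Rintegral => //.
  - by apply: (bounded_continuous_integrable _ cn) => y; rewrite normr_id; exact: f1.
  - exact: finite_measure_integrable_cst.
by apply: le_trans (ler_normB _ _) _; rewrite -[2]/(1 + 1) lerD.
Unshelve. all: by end_near. Qed.

Theorem proposition2p6 (R : realType) (E : completeNormedModType R)
  (S : R -> bounded_operator E E) (hS : C0_semigroup S)
  (A : set (E * E)) (hA : A = generator S)
  (H : completeNormedModType R) (dot : {dot H for (@idfun R)})
  (hH : is_hilbert dot) (B : bounded_operator H E)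
  (Q : R -> dual E -> E)
  (hQ : forall t : R, 0 <= t -> covariance_operator S dot B t (Q t))
  (mu : R -> probability (borel E) R)
  (hmu : forall t : R, 0 <= t -> centred_gaussian_radon (mu t) (Q t))
  (t s : R) (ht : 0 <= t) (hs : 0 <= s)
  (hperp : mutually_singular (mu t) (mu s)) :
  opnorm (BUCo (OU S mu)) (fun f => OU S mu t f \- OU S mu s f) = 2%:E.
Proof.
apply/eqP; rewrite eq_le; apply/andP; split.
  by apply: opnorm_OU_le => f [].
have [C [D [mC mD CD0 muC muD]]] := hperp.
have [d [M [d0 M0 SM]]] := C0_locally_bounded hS.
apply/lee_addgt0Pr => e e0.
(* The total loss is 5 e': 2 e' for each of the two concentration bounds and e' for the convergence
   of the averages. The cap at 1/2 forces [K] to be nonempty, since an empty [K] would leave mass 1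
   below e'. *)
pose e' := Num.min (e / 8) 2^-1.
have e'0 : 0 < e' by rewrite /e' lt_min invr_gt0 divr_gt0//=.
have e'8 : 8 * e' <= e.
  by rewrite mulrC -ler_pdivlMr// /e' ge_min lexx.
have e'1 : e' <= 2^-1 by rewrite /e' ge_min lexx orbT.
have [K [cK KC muK]] := (hmu _ ht).1 _ mC _ e'0.
have [L [cL LD muL]] := (hmu _ hs).1 _ mD _ e'0.
have K0 : K !=set0.
  apply/set0P/eqP => K0; move: muK; rewrite K0 setD0 muC lte_fin; lra.
have KL0 : K `&` L = set0.
  rewrite -subset0 => x [Kx Lx]; rewrite -CD0.
  by split; [exact: KC|exact: LD].
have [l [g [g1 gq gK gL]]] := compact_separation cK cL K0 KL0.
have cg : continuous g.
  have [W W0 HW] := trunc_seminorm_le l.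
  apply: (@lipschitz_continuous _ _ g (2 * W)) => x y.
  by apply: le_trans (gq x y) _; rewrite -mulrA ler_pM2l.
(* With [n.+2] the inequality r n < d is strict already at n = 0, as membership in [BUCo]
   requires. *)
pose r n := d / n.+2%:R.
have r0 n : 0 < r n by rewrite divr_gt0.
have rd n : r n < d by rewrite ltr_pdivrMr// ltr_pMr// ltr1n.
pose f n := orbit_average S d g (r n).
have [W HW] := orbit_average_lipschitz hS d0 M0 SM gq.
have cf n : continuous (f n).
  by apply: lipschitz_continuous; exact: HW.
have f1 n x : `|f n x| <= 1 by exact: (orbit_average_bound hS d0 M0 SM g1 gq x (r0 n)).
have fB n : BUCo (OU S mu) (f n).
  exact: (orbit_average_BUCo hS hH hQ hmu d0 M0 SM g1 gq (r0 n) (rd n)).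
have fg x : f n x @[n --> \oo] --> g x.
  have /cvg_at_rightP := @orbit_average_cvg _ _ _ hS _ _ d0 M0 SM _ _ gq x.
  apply; split; first exact: r0.
  rewrite -[0](mulr0 d); apply: cvgM; first exact: cvg_cst.
  by have := @cvg_harmonic R; rewrite -cvg_shiftS.
have OU0 a n : OU S mu a (f n) 0 = \int[mu a]_(y in [set: borel E]) f n y.
  by rewrite /OU; apply: eq_Rintegral => y _; rewrite linear0 add0r.
have intt : 1 - 2 * e' <= \int[mu t]_(y in [set: borel E]) g y.
  exact: (Rintegral_concentrated_ge mC muC cK muK cg g1 gK).
(* The function -g equals 1 on [L], so the concentration bound for [mu s] applies to it. *)
have ints : \int[mu s]_(y in [set: borel E]) g y <= - (1 - 2 * e').
  have cNg : continuous (fun x => - g x) by move=> x; apply: cvgN; exact: cg.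
  have Ng1 x : `|- g x| <= 1 by rewrite normrN.
  have NgL x : L x -> - g x = 1 by move=> Lx; rewrite gL// opprK.
  have := Rintegral_concentrated_ge mD muD cL muL cNg Ng1 NgL.
  have -> : \int[mu s]_(y in [set: borel E]) - g y =
      - \int[mu s]_(y in [set: borel E]) g y.
    rewrite -mulN1r -RintegralZl//; last exact: bounded_continuous_integrable g1.
    by apply: eq_Rintegral => y _; rewrite mulN1r.
  by rewrite lerNr.
pose I a (k : E -> R) := \int[mu a]_(y in [set: borel E]) k y.
have It : I t (f n) @[n --> \oo] --> I t g by exact: Rintegral_cvg_bounded.
have Is : I s (f n) @[n --> \oo] --> I s g by exact: Rintegral_cvg_bounded.
have Its : I t (f n) - I s (f n) @[n --> \oo] --> I t g - I s g by exact: cvgB.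
(* A single [f n] whose integrals are close enough to the limit serves as test function, evaluated
   at the point 0. *)
move/cvgrPdist_lt : Its => /(_ e' e'0)[n _ /(_ n (leqnn n))].
move=> /= /(le_lt_trans (ler_norm _)) hn.
apply: (@le_trans _ _ (`|(OU S mu t (f n) \- OU S mu s (f n)) 0| + e)%:E).
  rewrite lee_fin /= !OU0; apply: le_trans (lerD (ler_norm _) (lexx _)).
  by move: intt ints hn e'8; rewrite /I; lra.
rewrite EFinD leeD2r//.
apply: le_ereal_sup_tmp; exists (supnorm (OU S mu t (f n) \- OU S mu s (f n))).
  exists (f n) => //; split=> //=; apply: ge_ereal_sup => _ [x _ <-].
  by rewrite lee_fin.
apply: le_ereal_sup_tmp; exists `|(OU S mu t (f n) \- OU S mu s (f n)) 0|%:E => //.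
Qed.
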